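(* Let $\phi:\mathfrak{sl}(2,\mathbb{C})\to\mathfrak{sl}(n,\mathbb{C})$ be the Lie algebra homomorphism defined by $\phi(h)=h_1$, $\phi(e_1)=e_{12}$, $\phi(e_2)=e_{21}$. Let $\mathrm{ad}\circ\phi$ be the composition of $\phi$ and the adjoint representation $\mathrm{ad}$ of $\mathfrak{sl}(n,\mathbb{C})$. Then $$f_{\mathrm{ad}\circ\phi}(z_0,z_1,z_2,z_3)=z_0^{n^2-5n+6}\left(z_0^2-(z_1^2+z_2z_3)\right)^{2n-4}\left(z_0^2-4(z_1^2+z_2z_3)\right).$$
   Context: $\mathfrak{sl}(2,\mathbb{C})$ has basis $h=\begin{pmatrix}1&0\\0&-1\end{pmatrix}$, $e_1=\begin{pmatrix}0&1\\0&0\end{pmatrix}$, $e_2=\begin{pmatrix}0&0\\1&0\end{pmatrix}$. For a finite-dimensional complex representation $\varphi$ of $\mathfrak{sl}(2,\mathbb{C})$, its characteristic polynomial is $$f_{\varphi}(z_0,z_1,z_2,z_3)=\det\left(z_0 I+z_1\varphi(h)+z_2\varphi(e_1)+z_3\varphi(e_2)\right),$$ where $I$ is the identity. $e_{ij}$ denotes the complex $n\times n$ matrix with entry $1$ in row $i$, column $j$ and $0$ elsewhere; $\mathfrak{sl}(n,\mathbb{C})$ is the simple Lie algebra of type $\mathrm{A}_{n-1}$ with basis $h_i=e_{ii}-e_{i+1,i+1}$ ($1\le i\le n-1$) and $e_{ij}$ ($1\le i\ne j\le n$).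
   Formalization: The exponent of z_0 is corrected from n^2-5n+6 to n^2-4n+5: the determinant has degree dim sl(n) = n^2-1, while the printed right-hand side has degree n^2-n, so the printed formula fails for every n >= 2. *)

(* Defs.v *)
From HB Require Import structures.
From mathcomp Require Import all_boot all_order all_algebra.
From mathcomp Require Import reals complex mpoly.

Set Implicit Arguments.
Unset Strict Implicit.
Unset Printing Implicit Defensive.

Import GRing.Theory.
Local Open Scope ring_scope.

(* Finite-dimensional Lie algebras over a field. *)
HB.mixin Record Vector_isLie (K : fieldType) V & Vector K V := {
  lie : V -> V -> V;
  lieDl : forall (a : K) (x y z : V),
    lie (a *: x + y) z = a *: lie x z + lie y z;
  lieDr : forall (a : K) (x y z : V),
    lie x (a *: y + z) = a *: lie x y + lie x z;
  liexx : forall x : V, lie x x = 0;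
  lie_jacobi : forall x y z : V,
    lie x (lie y z) + lie y (lie z x) + lie z (lie x y) = 0
}.

#[short(type="lieType")]
HB.structure Definition Lie (K : fieldType) :=
  { V of Vector_isLie K V & Vector K V }.

Record lie_hom (K : fieldType) (g k : lieType K) := LieHom {
  lie_hom_fun :> 'Hom(g, k);
  lie_homP : forall x y : g,
    lie_hom_fun (lie x y) = lie (lie_hom_fun x) (lie_hom_fun y)
}.

Lemma lie_hom_comp_subproof (K : fieldType) (g k l : lieType K)
    (psi : lie_hom k l) (phi : lie_hom g k) (x y : g) :
  (psi \o phi)%VF (lie x y) = lie ((psi \o phi)%VF x) ((psi \o phi)%VF y).
Proof. by rewrite !lfunE /= !lie_homP. Qed.

Definition lie_hom_comp (K : fieldType) (g k l : lieType K)
    (psi : lie_hom k l) (phi : lie_hom g k) : lie_hom g l :=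
  LieHom (lie_hom_comp_subproof psi phi).

Section GeneralLinear.
Variables (K : fieldType) (V : vectType K).
Implicit Types f g h : 'End(V).

Definition end_lie f g : 'End(V) := (f \o g)%VF - (g \o f)%VF.

Fact end_lieDl (a : K) f g h :
  end_lie (a *: f + g) h = a *: end_lie f h + end_lie g h.
Proof.
by rewrite /end_lie comp_lfunDl comp_lfunDr -comp_lfunZl -comp_lfunZr scalerBr
  addrACA -opprD.
Qed.

Fact end_lieDr (a : K) f g h :
  end_lie f (a *: g + h) = a *: end_lie f g + end_lie f h.
Proof.
by rewrite /end_lie comp_lfunDl comp_lfunDr -comp_lfunZl -comp_lfunZr scalerBr
  addrACA -opprD.
Qed.

Fact end_liexx f : end_lie f f = 0. Proof. exact: subrr. Qed.

Fact end_lie_jacobi f g h :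
  end_lie f (end_lie g h) + end_lie g (end_lie h f)
    + end_lie h (end_lie f g) = 0.
Proof.
rewrite /end_lie !(comp_lfunDl, comp_lfunDr, comp_lfunNl, comp_lfunNr).
rewrite !comp_lfunA !opprB !addrA.
rewrite [LHS](ACl ((((((1*12)*(7*2))*(3*10))*(5*4))*(11*6))*(9*8)))/=.
by rewrite !subrr !addr0.
Qed.

HB.instance Definition _ := Vector_isLie.Build K 'End(V)
  end_lieDl end_lieDr end_liexx end_lie_jacobi.

End GeneralLinear.

Section Adjoint.
Variables (K : fieldType) (g : lieType K).
Implicit Types x y z : g.

Fact lie_linear x : linear (lie x).
Proof. by move=> a y z; rewrite lieDr. Qed.

HB.instance Definition _ x :=
  GRing.isSemilinear.Build K g g _ (lie x)
    (GRing.semilinear_linear (lie_linear x)).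

Lemma lieC x y : lie x y = - lie y x.
Proof.
have addl u v w : lie (u + v) w = lie u w + lie v w.
  by rewrite -[u]scale1r lieDl !scale1r.
have /eqP := liexx (x + y).
by rewrite addl !linearD /= !liexx add0r addr0 addr_eq0 => /eqP.
Qed.

Definition ad_fun x : 'End(g) := linfun (lie x).

Fact ad_fun_linear : linear ad_fun.
Proof.
move=> a x y; apply/lfunP=> z.
by rewrite add_lfunE scale_lfunE !lfunE /= lieDl.
Qed.

HB.instance Definition _ :=
  GRing.isSemilinear.Build K g 'End(g) _ ad_fun
    (GRing.semilinear_linear ad_fun_linear).

Fact ad_subproof x y :
  linfun ad_fun (lie x y) = lie (linfun ad_fun x) (linfun ad_fun y).
Proof.
rewrite !lfunE /=; apply/lfunP=> z.
rewrite [lie (ad_fun x) _]/(end_lie _ _) /end_lie !lfunE /= !lfunE /= !lfunE /=.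
have /eqP := lie_jacobi x y z.
rewrite [lie z x]lieC linearN /= [lie z (lie x y)]lieC.
by rewrite subr_eq0 => /eqP <-; rewrite !lfunE.
Qed.

Definition ad : lie_hom g 'End(g) := LieHom ad_subproof.

End Adjoint.

Section SpecialLinear.
Variables (K : fieldType) (n : nat).
Implicit Types A B : 'M[K]_n.

Definition sl_space : {vspace 'M[K]_n} :=
  lker (linfun (mxtrace : 'M[K]_n -> K^o)).

Lemma mem_sl_space A : (A \in sl_space) = (\tr A == 0).
Proof. by rewrite memv_ker lfunE. Qed.

Definition sl : Type := subvs_of sl_space.

HB.instance Definition _ := Vector.on sl.

Definition sl_val (x : sl) : 'M[K]_n := vsval x.

Fact sl_lie_subproof A B : A *m B - B *m A \in sl_space.
Proof. by rewrite mem_sl_space raddfB /= mxtrace_mulC subrr. Qed.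

Definition sl_lie (x y : sl) : sl :=
  Subvs (sl_lie_subproof (sl_val x) (sl_val y)).

Fact sl_lieDl (a : K) (x y z : sl) :
  sl_lie (a *: x + y) z = a *: sl_lie x z + sl_lie y z.
Proof.
apply: val_inj; rewrite linearP /=.
by rewrite mulmxDl -scalemxAl mulmxDr -scalemxAr scalerBr addrACA opprD.
Qed.

Fact sl_lieDr (a : K) (x y z : sl) :
  sl_lie x (a *: y + z) = a *: sl_lie x y + sl_lie x z.
Proof.
apply: val_inj; rewrite linearP /=.
by rewrite mulmxDl -scalemxAl mulmxDr -scalemxAr scalerBr addrACA opprD.
Qed.

Fact sl_liexx (x : sl) : sl_lie x x = 0.
Proof. by apply: val_inj; rewrite /= subrr. Qed.

Fact sl_lie_jacobi (x y z : sl) :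
  sl_lie x (sl_lie y z) + sl_lie y (sl_lie z x) + sl_lie z (sl_lie x y) = 0.
Proof.
apply: val_inj => /=; rewrite /sl_val /=.
rewrite !(mulmxBl, mulmxBr) !mulmxA !opprB !addrA.
rewrite [LHS](ACl ((((((1*12)*(7*2))*(3*10))*(5*4))*(11*6))*(9*8)))/=.
by rewrite !subrr !addr0.
Qed.

HB.instance Definition _ := Vector_isLie.Build K sl
  sl_lieDl sl_lieDr sl_liexx sl_lie_jacobi.

Fact sl_e_subproof (i j : 'I_n) : i != j -> delta_mx i j \in sl_space.
Proof.
move=> ij; rewrite mem_sl_space /mxtrace big1 // => k _.
by rewrite mxE; case: eqP => // ->; rewrite (negPf ij).
Qed.

Definition sl_e (i j : 'I_n) (ij : i != j) : sl := Subvs (sl_e_subproof ij).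

(* Indices start at 0, so that sl_h hi with hi : i.+1 < n is e_ii - e_(i+1,i+1)
   in 0-based numbering, that is h_(i+1) in the usual 1-based numbering. *)
Fact sl_h_subproof (i : nat) (hi : (i.+1 < n)%N) :
  delta_mx (Ordinal (ltnW hi)) (Ordinal (ltnW hi))
    - delta_mx (Ordinal hi) (Ordinal hi) \in sl_space.
Proof.
have tr1 (k : 'I_n) : \tr (delta_mx k k : 'M[K]_n) = 1.
  rewrite /mxtrace (bigD1 k) //= big1 ?addr0 ?mxE ?eqxx // => l lk.
  by rewrite mxE (negPf lk).
by rewrite mem_sl_space raddfB /= !tr1 subrr.
Qed.

Definition sl_h (i : nat) (hi : (i.+1 < n)%N) : sl :=
  Subvs (sl_h_subproof hi).

End SpecialLinear.

Definition sl2_h (K : fieldType) : sl K 2 := @sl_h K 2 0 isT.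
Definition sl2_e1 (K : fieldType) : sl K 2 := @sl_e K 2 ord0 ord_max isT.
Definition sl2_e2 (K : fieldType) : sl K 2 := @sl_e K 2 ord_max ord0 isT.

(* There is (exactly) one homomorphism from sl(2) to sl(n), 2 <= n, that sends
   h, e_1, e_2 to h_1, e_12, e_21: the embedding as the upper left block. *)
Section CornerEmbedding.
Variables (K : fieldType) (n : nat) (hn : (1 < n)%N).

Let P : 'M[K]_(2, n) := pid_mx 2.

Fact corner_PPt : P *m P^T = 1%:M.
Proof. by rewrite /P tr_pid_mx mul_pid_mx minnn (minn_idPr hn) pid_mx_1. Qed.

Fact corner_subproof (A : 'M[K]_2) :
  A \in sl_space K 2 -> P^T *m A *m P \in sl_space K n.
Proof.
by rewrite !mem_sl_space mxtrace_mulC mulmxA corner_PPt mul1mx.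
Qed.

Definition corner_fun (x : sl K 2) : sl K n :=
  Subvs (corner_subproof (valP x)).

Fact corner_linear : linear corner_fun.
Proof.
move=> a x y; apply: val_inj; rewrite linearP /=.
by rewrite mulmxDr mulmxDl -scalemxAr -scalemxAl.
Qed.

HB.instance Definition _ :=
  GRing.isSemilinear.Build K (sl K 2) (sl K n) _ corner_fun
    (GRing.semilinear_linear corner_linear).

Fact corner_lie (x y : sl K 2) :
  linfun corner_fun (lie x y)
  = lie (linfun corner_fun x) (linfun corner_fun y).
Proof.
rewrite !lfunE; apply: val_inj => /=; rewrite /sl_val /=.
rewrite mulmxBr mulmxBl !mulmxA.
by congr (_ - _); rewrite -(mulmxA _ P) corner_PPt mulmx1.
Qed.

Fact corner_delta (i j : 'I_2) :
  P^T *m delta_mx i j *m P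
  = delta_mx (widen_ord hn i) (widen_ord hn j) :> 'M[K]_n.
Proof.
rewrite -(mul_delta_mx (0 : 'I_1)) mulmxA -mulmxA -rowE -colE.
rewrite -(mul_delta_mx (0 : 'I_1)); congr (_ *m _);
  apply/matrixP=> k l; rewrite !mxE ?ord1 ?eqxx ?andbT /=.
  by rewrite -val_eqE /= ltn_ord andbT eq_sym.
by rewrite -val_eqE /= ltn_ord andbT eq_sym.
Qed.

Lemma corner_exists : exists phi : lie_hom (sl K 2) (sl K n),
  [/\ phi (sl2_h K) = sl_h K hn,
      phi (sl2_e1 K) = @sl_e K n (Ordinal (ltnW hn)) (Ordinal hn) isT
    & phi (sl2_e2 K) = @sl_e K n (Ordinal hn) (Ordinal (ltnW hn)) isT].
Proof.
exists (LieHom corner_lie); split; apply: val_inj; rewrite /= lfunE /=.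
- rewrite mulmxBr mulmxBl !corner_delta.
  by congr (delta_mx _ _ - delta_mx _ _); apply: val_inj.
- by rewrite corner_delta; congr delta_mx; apply: val_inj.
- by rewrite corner_delta; congr delta_mx; apply: val_inj.
Qed.

End CornerEmbedding.

Section CharPoly.
Variables (K : fieldType) (V : vectType K).

(* The transpose of the usual matrix of f, since MathComp acts on row vectors;
   its determinant is that of f, in any basis of V. *)
Definition end_mx (f : 'End(V)) : 'M[K]_(\dim {:V}) :=
  passmx.mxof (vbasis {:V}) (vbasis {:V}) f.

Definition sl2_charpoly (phi : lie_hom (sl K 2) 'End(V)) : {mpoly K[4]} :=
  let M (x : sl K 2) : 'M[{mpoly K[4]}]_(\dim {:V}) :=
    map_mx (@mpolyC 4 K) (end_mx (phi x)) in
  \det ('X_0 *: 1%:M + 'X_1 *: M (sl2_h K)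
        + 'X_2 *: M (sl2_e1 K) + 'X_3 *: M (sl2_e2 K)).

End CharPoly.

(* Main.v *)
Require Import Defs.
From HB Require Import structures.
From mathcomp Require Import all_boot all_order all_algebra.
From mathcomp Require Import reals complex mpoly.
From mathcomp Require Import ring zify.

Set Implicit Arguments.
Unset Strict Implicit.
Unset Printing Implicit Defensive.

Import GRing.Theory Num.Theory passmx.

Local Open Scope ring_scope.

(** Both sides are polynomials over an infinite field, so it is enough to
    compare their values at the points [(a, x, y, z)] where a chosen nonzero
    polynomial does not vanish ([meval_eq0]).  At such a point the left-hand
    side is the determinant of [a + ad X] on sl(n), where [X] is the matrix
    with upper left block [[x, y], [z, -x]] and zeros elsewhere.

    Three facts compute this determinant.
    - sl(n) is a hyperplane of gl(n), stable under [ad X] and complementary to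
      the scalar matrices, which [ad X] kills.  Hence the determinant of
      [a + ad X] on gl(n) is [a] times the one on sl(n) ([det_adgl_sl]).
    - If [x^2 + y z = s^2] with [s] and [y] nonzero, then [X] is similar to
      [diag(s, -s, 0, ..., 0)] ([diagonalise_corner]), and conjugating [X]
      conjugates [ad X] on gl(n) ([det_adgl_conj]).
    - For [D = diag(d_1, ..., d_n)] the matrix units diagonalise [ad D], with
      eigenvalues [d_i - d_j] ([det_adgl_diag]).

    With weights [s, -s, 0, ..., 0] the product of the [a + d_i - d_j] is
    [a^((n-2)^2+2) (a^2 - s^2)^(2n-4) (a^2 - 4 s^2)] ([det_adgl_weights]), and
    removing one factor [a] leaves the exponent [(n-2)^2 + 1 = n^2 - 4n + 5].
    Points with [a = 0], [y = 0] or [x^2 + y z = 0] escape the argument; they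
    are the zeros of ['X_2 ('X_1^2 + 'X_2 'X_3) 'X_0], which can be cancelled
    because polynomials form a domain. *)

(** * Polynomials that vanish everywhere *)

(** In characteristic zero the naturals already give too many roots. *)
Lemma poly_horner_eq0 (F : numFieldType) (p : {poly F}) :
  (forall x, p.[x] = 0) -> p = 0.
Proof.
move=> p0; apply/eqP/negPn/negP => nz_p.
have := max_poly_roots (rs := [seq i%:R | i <- iota 0 (size p)]) nz_p.
rewrite map_inj_uniq ?iota_uniq; last by apply: mulrIn; rewrite oner_eq0.
rewrite size_map size_iota ltnn => roots_lt; suff: false by [].
by apply: roots_lt => //; apply/allP => x _; apply/rootP.
Qed.

Lemma widen_ord_lift_max n (i : 'I_n) :
  widen_ord (leqnSn n) i = lift ord_max i.
Proof. by apply: val_inj; rewrite /= /bump leqNgt ltn_ord. Qed.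

Lemma horner_meval_muni (F : fieldType) n (p : {mpoly F[n.+1]})
    (v : 'I_n.+1 -> F) :
  (map_poly (meval (v \o widen_ord (leqnSn n))) (muni p)).[v ord_max] = p.@[v].
Proof.
rewrite muniE mevalE raddf_sum /= horner_sum.
apply: eq_bigr => m _.
rewrite /= map_polyZ map_polyXn !hornerE /= mevalZ mevalX big_ord_recr /= mulrA.
by congr (_ * _ * _); apply: eq_bigr => i _; rewrite mnmE.
Qed.

(** Substituting the last variable back undoes [muni]; this makes [muni]
    injective, which is what the induction on the number of variables uses. *)
Lemma mwiden_muniK (F : fieldType) n :
  cancel (@muni n F) (fun q => (map_poly (@mwiden n F) q).['X_ord_max]).
Proof.
move=> p; rewrite muniE raddf_sum horner_sum [RHS]mpolyE.
apply: eq_bigr => m _.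
rewrite /= map_polyZ map_polyXn !hornerE /= mwidenZ mwidenX -scalerAl.
congr (_ *: _); rewrite mpolyXn -mpolyXD; congr 'X_[_]; apply/mnmP => i.
rewrite mnmDE mulmnE mnm1E.
case: (unliftP ord_max i) => [j|] ->; last first.
  by rewrite mnmwiden_ordmax eqxx mul1n.
rewrite -widen_ord_lift_max mnmwiden_widen mnmE -val_eqE /= gtn_eqF ?ltn_ord //.
by rewrite addn0.
Qed.

Lemma meval_eq0 (F : numFieldType) n (p : {mpoly F[n]}) :
  (forall v, p.@[v] = 0) -> p = 0.
Proof.
elim: n p => [|n IHn] p p0.
  have pC : p = (p@_0)%:MP.
    apply/mpolyP => m; rewrite mcoeffC.
    have -> : m = 0%MM by apply/mnmP; case.
    by rewrite eqxx mulr1.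
  by move: (p0 (fun=> 0)); rewrite pC mevalC => ->; rewrite mpolyC0.
rewrite -[p]mwiden_muniK; suff -> : muni p = 0 by rewrite rmorph0 horner0.
apply/polyP => i; rewrite coef0; apply: IHn => w.
rewrite -coef_map; suff -> : map_poly (meval w) (muni p) = 0 by rewrite coef0.
apply: poly_horner_eq0 => x.
pose v (j : 'I_n.+1) := if unlift ord_max j is Some k then w k else x.
have <- : v ord_max = x by rewrite /v unlift_none.
have <- : map_poly (meval (v \o widen_ord (leqnSn n))) (muni p)
        = map_poly (meval w) (muni p).
  apply: eq_map_poly => q; apply: meval_eq => j.
  by rewrite /= /v widen_ord_lift_max liftK.
by rewrite horner_meval_muni.
Qed.

(** * The adjoint action on all square matrices *)

Section GeneralLinearAdjoint.
Variables (F : fieldType) (n : nat).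

(** The matrix of [ad A] on gl(n), acting on row vectors through [mxvec]. *)
Definition adgl (A : 'M[F]_n) : 'M[F]_(n * n) := lin_mulmx A - lin_mulmxr A.

(** The matrix of conjugation by [G] on gl(n), in the same encoding. *)
Definition conjgl (G : 'M[F]_n) : 'M[F]_(n * n) :=
  lin_mulmx G *m lin_mulmxr (invmx G).

Lemma mul_mxvec_adgl A (Z : 'M[F]_n) :
  mxvec Z *m adgl A = mxvec (A *m Z - Z *m A).
Proof. by rewrite mulmxBr !mul_vec_lin linearB. Qed.

Lemma mul_mxvec_shift_adgl a A (Z : 'M[F]_n) :
  mxvec Z *m (a%:M + adgl A) = mxvec (a *: Z + (A *m Z - Z *m A)).
Proof. by rewrite mulmxDr mul_mxvec_adgl mul_mx_scalar linearP. Qed.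

Lemma mul_mxvec_conjgl G (Z : 'M[F]_n) :
  mxvec Z *m conjgl G = mxvec (G *m Z *m invmx G).
Proof. by rewrite mulmxA !mul_vec_lin. Qed.

Lemma mxvec_ext m p q (A B : 'M[F]_(m * p, q)) :
  (forall Z : 'M[F]_(m, p), mxvec Z *m A = mxvec Z *m B) -> A = B.
Proof.
move=> AB; apply/row_matrixP => k; rewrite !rowE.
by case/mxvec_indexP: k => i j; rewrite -mxvec_delta.
Qed.

(** The sizes [p] and [q] are only propositionally equal, so that [T] may be
    assembled from blocks without casts. *)
Lemma det_intertwine p q (T : 'M[F]_(p, q)) L M :
  p = q -> row_free T -> T *m L = M *m T -> \det L = \det M.
Proof.
move=> epq; case: _ / epq T L => T L; rewrite row_free_unit => uT TL.
have : \det (T *m L) = \det (M *m T) by rewrite TL.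
rewrite !det_mulmx mulrC => /mulIf -> //.
by rewrite -unitfE -unitmxE.
Qed.

(** The matrix units are eigenvectors: [[D, e_ij] = (d_i - d_j) e_ij]. *)
Lemma det_adgl_diag a (d : 'rV_n) :
  \det (a%:M + adgl (diag_mx d)) = \prod_i \prod_j (a + d 0 i - d 0 j).
Proof.
have ->: a%:M + adgl (diag_mx d)
       = diag_mx (mxvec (\matrix_(i, j) (a + d 0 i - d 0 j))).
  apply: mxvec_ext => Z; rewrite mul_mxvec_shift_adgl.
  apply/rowP => k; case/mxvec_indexP: k => i j.
  rewrite mul_diag_mx mul_mx_diag mul_mx_diag.
  by rewrite !(mxE, mxvecE); ring.
rewrite det_diag (reindex _ (curry_mxvec_bij _ _)) /= pair_bigA /=.
by apply: eq_bigr => -[i j] _ /=; rewrite mxvecE mxE.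
Qed.

(** Conjugation by [G] is a Lie algebra automorphism, so it intertwines [ad D]
    with [ad (G D G^-1) = ad A]. *)
Lemma det_adgl_conj a (A D G : 'M[F]_n) :
  G \in unitmx -> A *m G = G *m D ->
  \det (a%:M + adgl A) = \det (a%:M + adgl D).
Proof.
move=> uG AG; have conjE := mul_mxvec_conjgl G.
apply: (@det_intertwine _ _ (conjgl G)) => //.
  apply/row_freeP; exists (conjgl (invmx G)).
  apply: mxvec_ext => Z; rewrite mulmxA !conjE mul_mxvec_conjgl mulmx1 invmxK.
  by rewrite !mulmxA mulVmx // mul1mx mulmxKV.
apply: mxvec_ext => Z; rewrite [LHS]mulmxA [RHS]mulmxA conjE.
rewrite !mul_mxvec_shift_adgl conjE; congr mxvec.
rewrite mulmxDr mulmxDl -scalemxAr -scalemxAl; congr (_ + _).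
rewrite mulmxBr mulmxBl !mulmxA AG; congr (_ - _).
rewrite -!mulmxA; congr (_ *m (_ *m _)).
by apply: (canRL (mulmxK uG)); rewrite -mulmxA AG mulKmx.
Qed.

End GeneralLinearAdjoint.

(** * From sl(n) to gl(n) *)

Section SpecialLinearAdjoint.
Variables (F : fieldType) (n : nat).

Fact sl_val_linear : linear (@sl_val F n).
Proof. by move=> a x y; rewrite /sl_val linearP. Qed.

HB.instance Definition _ :=
  GRing.isSemilinear.Build F (sl F n) 'M[F]_n _ (@sl_val F n)
    (GRing.semilinear_linear sl_val_linear).

(** The matrix of the inclusion of sl(n) in gl(n), from the basis in which
    [end_mx] is written to the matrix units. *)
Definition sl_mx : 'M[F]_(\dim {:sl F n}, n * n) :=
  lin1_mx (mxvec \o @sl_val F n \o vecof (vbasis {:sl F n})).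

Lemma dim_sl : (0 < n)%N -> (1 + \dim {:sl F n} = n * n)%N.
Proof.
move=> n_gt0; rewrite [\dim {:sl F n}]dimvf.
have trace_onto : (linfun (mxtrace : 'M[F]_n -> F^o) @: fullv = fullv)%VS.
  apply/eqP; rewrite eqEsubv subvf /=; apply/subvP => x _.
  apply/memv_imgP; exists (x *: delta_mx (Ordinal n_gt0) (Ordinal n_gt0)).
    exact: memvf.
  rewrite lfunE /= linearZ /= /mxtrace (bigD1 (Ordinal n_gt0)) //= big1.
    by rewrite mxE !eqxx addr0 mulr1.
  by move=> i ni; rewrite mxE (negPf ni).
have := limg_ker_dim (linfun (mxtrace : 'M[F]_n -> F^o)) fullv.
by rewrite trace_onto capfv !dimvf addnC.
Qed.

Lemma mul_sl_mx u :
  u *m sl_mx = mxvec (sl_val (vecof (vbasis {:sl F n}) u)).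
Proof. by rewrite mul_rV_lin1. Qed.

Lemma sl_mx_adgl (y : sl F n) :
  sl_mx *m adgl (sl_val y) = end_mx (ad (sl F n) y) *m sl_mx.
Proof.
apply/row_matrixP => i; rewrite !rowE [LHS]mulmxA [RHS]mulmxA.
rewrite !mul_sl_mx mul_mxvec_adgl mul_mxof rVofK ?vbasisP //.
by rewrite !lfunE.
Qed.

(** In the decomposition of gl(n) as scalars plus sl(n), the operator
    [a + ad y] is block diagonal, with [a] on the scalars. *)
Lemma det_adgl_sl a (y : sl F n) : n%:R != 0 :> F ->
  \det (a%:M + adgl (sl_val y)) = a * \det (a%:M + end_mx (ad (sl F n) y)).
Proof.
move=> n_neq0; have n_gt0 : (0 < n)%N by case: n n_neq0 => //; rewrite eqxx.
pose T := col_mx (mxvec 1%:M) sl_mx.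
have <- : \det (block_mx (a%:M : 'M_1) 0 0 (a%:M + end_mx (ad (sl F n) y)))
  = a * \det (a%:M + end_mx (ad (sl F n) y)).
  by rewrite det_ublock det_scalar1.
apply: (@det_intertwine _ _ _ T); first exact: dim_sl.
  apply: inj_row_free => v; rewrite -[v]hsubmxK.
  set c := lsubmx v; set u := rsubmx v.
  rewrite mul_row_col mul_sl_mx [c]mx11_scalar mul_scalar_mx -linearP.
  move/(congr1 vec_mx); rewrite mxvecK linear0; set w := vecof _ _ => eq0.
  (* The trace of [c I + w] is [c n]: a scalar in sl(n) vanishes as n does
     not vanish in F. *)
  have c0 : c 0 0 = 0.
    have /eqP tr_w : \tr (sl_val w) == 0 by rewrite -mem_sl_space subvsP.
    have := congr1 mxtrace eq0; rewrite linearP /= tr_w mxtrace1 mxtrace0 addr0.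
    by move/eqP; rewrite mulf_eq0 (negPf n_neq0) orbF => /eqP.
  move: eq0; rewrite c0 scale0r add0r => w0.
  suff -> : u = 0 by rewrite raddf0 row_mx0.
  apply/eqP; rewrite -(vecof_eq0 (vbasisP _)); apply/eqP.
  exact: val_inj.
rewrite mul_col_mx mul_block_col !mul0mx addr0 add0r; congr col_mx.
  rewrite mul_mxvec_shift_adgl mulmx1 mul1mx subrr addr0 linearZ /=.
  by rewrite mul_scalar_mx.
by rewrite mulmxDr mulmxDl sl_mx_adgl mul_mx_scalar mul_scalar_mx.
Qed.

End SpecialLinearAdjoint.

Lemma meval_sl2_charpoly (F : fieldType) (V : vectType F)
    (psi : lie_hom (sl F 2) 'End(V)) (v : 'I_4 -> F) :
  (sl2_charpoly psi).@[v]
  = \det ((v 0)%:M + end_mx (psi (v 1 *: sl2_h F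
       + v 2 *: sl2_e1 F + v 3 *: sl2_e2 F))).
Proof.
rewrite /sl2_charpoly -det_map_mx; congr (\det _).
rewrite /end_mx !linearD !linearZ /=.
apply/matrixP=> i j; rewrite !mxE !(mevalD, mevalM, mevalXU, mevalC) /=.
by rewrite rmorph_nat mulr_natr !addrA.
Qed.

(** * Diagonalisation of the corner block *)

Section Corner.
Variables (F : fieldType) (n : nat) (hn : (1 < n)%N).

Let i0 : 'I_n := Ordinal (ltnW hn).
Let i1 : 'I_n := Ordinal hn.

Definition corner (A : 'M[F]_2) : 'M[F]_n :=
  (pid_mx 2 : 'M[F]_(2, n))^T *m A *m pid_mx 2.

Fact corner_is_linear : linear corner.
Proof. by move=> a A B; rewrite /corner linearP mulmxDl -scalemxAl. Qed.

HB.instance Definition _ :=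
  GRing.isSemilinear.Build F 'M[F]_2 'M[F]_n _ corner
    (GRing.semilinear_linear corner_is_linear).

Lemma cornerM A B : corner A *m corner B = corner (A *m B).
Proof.
rewrite /corner !mulmxA; congr (_ *m _ *m _); rewrite -!mulmxA.
by rewrite (corner_PPt F hn) mulmx1.
Qed.

(** A 2 x 2 similarity, extended by the identity on the remaining
    coordinates, gives a similarity of the corner matrices. *)
Lemma corner_similar (A D g : 'M[F]_2) :
  g \in unitmx -> A *m g = g *m D ->
  exists2 G, G \in unitmx & corner A *m G = G *m corner D.
Proof.
move=> ug Ag; pose ext B := corner B + (1%:M - corner 1%:M).
have corner_ext A' B : corner A' *m ext B = corner (A' *m B).
  by rewrite mulmxDr mulmxBr !cornerM !mulmx1 subrr addr0.
have ext_corner A' B : ext B *m corner A' = corner (B *m A').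
  by rewrite mulmxDl mulmxBl !cornerM !mul1mx subrr addr0.
exists (ext g); last by rewrite corner_ext ext_corner Ag.
have /mulmx1_unit[] // : ext g *m ext (invmx g) = 1%:M.
rewrite {2}/ext mulmxDr mulmxBr mulmx1 !ext_corner mulmx1 mulmxV // /ext.
by rewrite [corner g + _]addrC addrK addrCA subrr addr0.
Qed.

Lemma diagonalise_corner (x y z s : F) :
  s ^+ 2 = x ^+ 2 + y * z -> s != 0 -> y != 0 -> 2%:R != 0 :> F ->
  exists2 G : 'M[F]_n, G \in unitmx &
    (x *: (delta_mx i0 i0 - delta_mx i1 i1)
     + y *: delta_mx i0 i1 + z *: delta_mx i1 i0) *m G
    = G *m diag_mx (s *: (delta_mx 0 i0 - delta_mx 0 i1)).
Proof.
move=> s2 s_neq0 y_neq0 two_neq0.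
pose A : 'M[F]_2 := x *: (delta_mx 0 0 - delta_mx 1 1)
     + y *: delta_mx 0 1 + z *: delta_mx 1 0.
pose D : 'M[F]_2 := s *: (delta_mx 0 0 - delta_mx 1 1).
(* The columns (y, s - x) and (y, -s - x) are eigenvectors for s and -s. *)
pose g : 'M[F]_2 := \matrix_(i, j)
  (if i == 0 then y else (if j == 0 then s else - s) - x).
have Ag : A *m g = g *m D.
  apply/matrixP => i j; rewrite !mxE !big_ord_recl !big_ord0 !mxE.
  case: i j => [[|[|//]] ?] [[|[|//]] ?];
    by rewrite /= ?(mulr0n, mulr1n); ring: s2.
have ug : g \in unitmx.
  rewrite unitmxE (expand_det_row _ 0) !big_ord_recl big_ord0 /cofactor.
  rewrite !det_mx11 !mxE /= unitfE /= /bump /= addn0 expr0 expr1.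
  have -> : y * (1 * (- s - x)) + (y * (-1 * (s - x)) + 0) = - (2%:R * s * y).
    by ring.
  by rewrite oppr_eq0 !mulf_neq0.
have [G uG] := corner_similar ug Ag.
have cornerE i j : corner (delta_mx i j)
    = delta_mx (widen_ord hn i) (widen_ord hn j) by exact: corner_delta.
have e0 : widen_ord hn 0 = i0 by apply: val_inj.
have e1 : widen_ord hn 1 = i1 by apply: val_inj.
have -> : corner A = x *: (delta_mx i0 i0 - delta_mx i1 i1)
    + y *: delta_mx i0 i1 + z *: delta_mx i1 i0.
  by rewrite linearD linearD !linearZ linearB /= !cornerE !e0 !e1.
have -> : corner D = s *: (delta_mx i0 i0 - delta_mx i1 i1).
  by rewrite linearZ linearB /= !cornerE !e0 !e1.
move=> XG; exists G => //; rewrite XG; congr (_ *m _).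
apply/matrixP => i j; rewrite !mxE /=.
case: (eqVneq i j) => [<-|ij]; first by rewrite !andbb.
suff no k : (i == k) && (j == k) = false by rewrite !no subrr mulr0.
by apply: contraNF ij => /andP[/eqP-> /eqP->].
Qed.

Lemma prod_weights (f : F -> F) s
    (d : 'rV[F]_n := s *: (delta_mx 0 i0 - delta_mx 0 i1)) :
  \prod_i f (d 0 i) = f s * f (- s) * f 0 ^+ (n - 2).
Proof.
have i10 : i1 != i0 by [].
rewrite (bigD1 i0) // (bigD1 i1) //= mulrA !mxE !eqxx eq_sym (negPf i10) /=.
rewrite subr0 sub0r mulr1 mulrN1; congr (_ * _).
rewrite (eq_bigr (fun=> f 0)) => [|i /andP[ni0 ni1]]; last first.
  by rewrite !mxE (negPf ni0) (negPf ni1) subrr mulr0.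
rewrite prodr_const; congr (_ ^+ _).
have /eq_card -> : [pred i | (i != i0) && (i != i1)] =i ~: [set i0; i1].
  by move=> i; rewrite !inE negb_or.
by rewrite cardsCs setCK card_ord cards2 eq_sym i10.
Qed.

(** The factor [a] set apart on the right is the contribution of the scalar
    matrices, so that what remains is the value on sl(n). *)
Lemma det_adgl_weights a s :
  \det (a%:M + adgl (diag_mx (s *: (delta_mx 0 i0 - delta_mx 0 i1) : 'rV[F]_n)))
  = a * (a ^+ (n ^ 2 + 5 - 4 * n) * (a ^+ 2 - s ^+ 2) ^+ (2 * n - 4)
    * (a ^+ 2 - 4%:R * s ^+ 2)).
Proof.
rewrite det_adgl_diag.
under eq_bigr => i _ do rewrite (prod_weights (fun t => a + _ - t)).
rewrite (prod_weights
  (fun t => (a + t - s) * (a + t - - s) * (a + t - 0) ^+ (n - 2))).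
have [m ->] : exists m, n = m.+2 by exists n.-2; case: n hn => [|[]].
have -> : (m.+2 - 2 = m)%N by rewrite subn2.
have -> : (m.+2 ^ 2 + 5 - 4 * m.+2 = (m * m).+1)%N.
  by apply/eqP; rewrite -(eqn_add2r (4 * m.+2)) subnK; nia.
have -> : (2 * m.+2 - 4 = m + m)%N by lia.
rewrite subr_sqr !exprD !exprMn exprS exprM !subr0 !addr0 opprK.
by ring.
Qed.

End Corner.

(** * The characteristic polynomial *)

(** Over any algebraically closed field with a norm: square roots exist and
    the characteristic is zero. *)
Lemma sl2_charpoly_ad_corner (K : numClosedFieldType) (n : nat) (hn : (1 < n)%N)
    (phi : lie_hom (sl K 2) (sl K n))
    (phi_h : phi (sl2_h K) = sl_h K hn)
    (phi_e1 : phi (sl2_e1 K)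
              = @sl_e K n (Ordinal (ltnW hn)) (Ordinal hn) isT)
    (phi_e2 : phi (sl2_e2 K)
              = @sl_e K n (Ordinal hn) (Ordinal (ltnW hn)) isT) :
  sl2_charpoly (lie_hom_comp (ad (sl K n)) phi)
  = 'X_0 ^+ (n ^ 2 + 5 - 4 * n)
    * ('X_0 ^+ 2 - ('X_1 ^+ 2 + 'X_2 * 'X_3)) ^+ (2 * n - 4)
    * ('X_0 ^+ 2 - 4%:R * ('X_1 ^+ 2 + 'X_2 * 'X_3)).
Proof.
have X_neq0 (i : 'I_4) : 'X_i != 0 :> {mpoly K[4]}.
  apply/eqP => /(congr1 (meval (fun=> 1))); rewrite mevalXU meval0 => /eqP.
  by rewrite oner_eq0.
have q_neq0 : 'X_1 ^+ 2 + 'X_2 * 'X_3 != 0 :> {mpoly K[4]}.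
  apply/eqP => /(congr1 (meval (fun i => (i == 1)%:R))).
  rewrite mevalD !mevalM !mevalXU meval0 /= mulr1 mulr0 addr0 => /eqP.
  by rewrite oner_eq0.
apply/eqP; rewrite -subr_eq0; apply/eqP.
(* 'X_0 pays for the scalar matrices, 'X_2 and q make the corner block
   diagonalisable. *)
apply: (mulfI (mulf_neq0 (mulf_neq0 (X_neq0 2) q_neq0) (X_neq0 0))).
rewrite mulr0; apply: meval_eq0 => v.
set lhs := sl2_charpoly _.
rewrite !(rmorph_nat, rmorphXn, rmorphM, rmorphB, rmorphD) /= !mevalXU.
set a := v 0; set x := v 1; set y := v 2; set z := v 3.
have [->|y_neq0] := eqVneq y 0; first by rewrite !(mulr0, mul0r).
set s := sqrtC (x ^+ 2 + y * z).
have s2 : s ^+ 2 = x ^+ 2 + y * z by rewrite sqrtCK.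
rewrite -s2; have [->|s_neq0] := eqVneq s 0.
  by rewrite expr0n !(mulr0, mul0r).
have two_neq0 : 2%:R != 0 :> K by rewrite pnatr_eq0.
have n_neq0 : n%:R != 0 :> K by rewrite pnatr_eq0 -lt0n ltnW.
have [G uG XG] := diagonalise_corner hn s2 s_neq0 y_neq0 two_neq0.
rewrite -mulrA mulrBr.
suff -> : a * lhs.@[v] = \det (a%:M + adgl (sl_val (x *: sl_h K hn
    + y *: @sl_e K n (Ordinal (ltnW hn)) (Ordinal hn) isT
    + z *: @sl_e K n (Ordinal hn) (Ordinal (ltnW hn)) isT))).
  by rewrite (det_adgl_conj _ uG XG) det_adgl_weights subrr !mulr0.
rewrite (det_adgl_sl _ _ n_neq0) meval_sl2_charpoly.
congr (_ * \det (_ + end_mx _)).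
by rewrite comp_lfunE !linearD !linearZ /= phi_h phi_e1 phi_e2.
Qed.

(* The exponent of 'X_0 is n^2 - 4n + 5, the multiplicity forced by
   dim sl(n) = n^2 - 1; the value n^2 - 5n + 6 in the source leaves out a
   factor z_0^(n-1) and gives a right-hand side of degree n^2 - n. *)
Theorem theorem6p1 (R : realType) (n : nat) (hn : (1 < n)%N)
    (phi : lie_hom (sl R[i] 2) (sl R[i] n))
    (phi_h : phi (sl2_h R[i]) = sl_h R[i] hn)
    (phi_e1 : phi (sl2_e1 R[i])
              = @sl_e R[i] n (Ordinal (ltnW hn)) (Ordinal hn) isT)
    (phi_e2 : phi (sl2_e2 R[i])
              = @sl_e R[i] n (Ordinal hn) (Ordinal (ltnW hn)) isT) :
  sl2_charpoly (lie_hom_comp (ad (sl R[i] n)) phi)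
  = 'X_0 ^+ (n ^ 2 + 5 - 4 * n)
    * ('X_0 ^+ 2 - ('X_1 ^+ 2 + 'X_2 * 'X_3)) ^+ (2 * n - 4)
    * ('X_0 ^+ 2 - 4%:R * ('X_1 ^+ 2 + 'X_2 * 'X_3)).
Proof. exact: sl2_charpoly_ad_corner. Qed.
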